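(* Let $V$ be a set of $n$ points in a metric space with doubling dimension $d$, let $\alpha>0$ and $0\le\varepsilon\le1$, and let $V=V_0\supseteq V_1\supseteq\cdots\supseteq V_m$ be the sequence of nets described in the context, with nearest-point maps $\pi_k:V_k\to V_{k+1}$ inducing simplicial maps $h_k$. Then the persistence diagram of the Rips filtration $$\mathcal R^\alpha(V)\hookrightarrow\mathcal R^{(1+\varepsilon)\alpha}(V)\hookrightarrow\cdots\hookrightarrow\mathcal R^{(1+\varepsilon)^m\alpha}(V)$$ is $\frac{3\log(1+\varepsilon)}{2}$-approximated (at the log-scale) by the persistence diagram of the sequence of simplicial maps $$\mathcal R^\alpha(V_0)\stackrel{h_0}{\longrightarrow}\mathcal R^{\alpha(1+\varepsilon)}(V_1)\stackrel{h_1}{\longrightarrow}\cdots\stackrel{h_{m-1}}{\longrightarrow}\mathcal R^{\alpha(1+\varepsilon)^m}(V_m).$$ Moreover, the $p$-skeleton of each simplicial complex $\mathcal R^{\alpha(1+\varepsilon)^k}(V_k)$, $0\le k\le m$, involved in the latter sequence has size $O\left((\tfrac1\varepsilon)^{O(dp)}\,n\right)$.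
   Context: Homology is simplicial homology with $\mathbb{Z}_2$ coefficients. $D$ denotes the metric. The doubling dimension of a metric space is the smallest $d$ such that every ball of radius $r$ can be covered by at most $2^d$ balls of radius $r/2$. For a finite point set $W$, the Rips complex $\mathcal R^r(W)$ has as simplices the subsets $\{u_0,\dots,u_k\}\subseteq W$ with $D(u_i,u_j)\le r$ for all $i,j$. A subset $W'\subseteq W$ is a $\delta$-net of $W$ if (i) for every $w\in W$ there is $w'\in W'$ with $D(w,w')\le\delta$, and (ii) no two distinct points of $W'$ are within distance $\delta$ of each other. Set $V_0:=V$ and let $V_{k+1}$ be a $\frac{\alpha\varepsilon^2}{2}(1+\varepsilon)^{k-1}$-net of $V_k$, $k=0,\dots,m-1$. The map $\pi_k:V_k\to V_{k+1}$ sends $v$ to the point of $V_{k+1}$ closest to $v$; it induces a well-defined simplicial map $h_k:\mathcal R^{\alpha(1+\varepsilon)^k}(V_k)\to\mathcal R^{\alpha(1+\varepsilon)^{k+1}}(V_{k+1})$. Persistence diagrams at the log-scale: the $k$-th complex of each sequence is placed at scale $\log(\alpha(1+\varepsilon)^k)$, and in each homology degree the persistence diagram records the births and deaths, at these scales, of the intervals in the decomposition of the induced persistence module. One diagram $c$-approximates another if, in each homology degree, their bottleneck distance is at most $c$.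
   Formalization: The size bound for k=0 is stated only when distinct points of V are more than (αε²/2)(1+ε)^(-2) apart (it is false for arbitrary V); size bounds need ε>0; intervals alive at the last index die at the last scale log(α(1+ε)^m), since infinite deaths would make the claim false. *)

(* Defs.v *)
From HB Require Import structures.
From mathcomp Require Import all_boot all_order all_algebra finmap.
From mathcomp Require Import all_classical all_reals all_analysis.

Set Implicit Arguments.
Unset Strict Implicit.
Unset Printing Implicit Defensive.

Import Order.TTheory GRing.Theory Num.Theory.

Local Open Scope ring_scope.

(* For W a subspace of U, the quotient U / W is realized on the complement
   U :\: W of W in U; the class of x \in U is its component along W, see
   quotv_projP and quotv_proj_surj. *)
Section Quotient.
Variables (F : fieldType) (vT : vectType F).
Implicit Types U W : {vspace vT}.

Definition quotv U W : vectType F := subvs_of (U :\: W)%VS.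

Definition quotv_proj U W : 'Hom(vT, quotv U W) :=
  linfun (fun x : vT => vsproj (U :\: W)%VS (addv_pi1 U W x)).

Lemma quotv_projE U W x :
  quotv_proj U W x = vsproj (U :\: W)%VS (addv_pi1 U W x).
Proof.
have lin : linear (fun x : vT => vsproj (U :\: W)%VS (addv_pi1 U W x)).
  by move=> a u v; rewrite !linearP.
pose ml := GRing.isLinear.Build _ _ _ _ _ lin.
pose f : {linear vT -> quotv U W} := HB.pack
  (fun x : vT => vsproj (U :\: W)%VS (addv_pi1 U W x)) ml.
exact: (lfunE f).
Qed.

Let pi1_mem U W x : addv_pi1 U W x \in (U :\: W)%VS.
Proof. exact: memv_pi. Qed.

Lemma quotv_projP U W x : (W <= U)%VS -> x \in U ->
  (quotv_proj U W x == 0) = (x \in W).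
Proof.
move=> sWU xU; rewrite quotv_projE.
have xUW : x \in (U + W)%VS by rewrite (subvP (addvSl _ _)).
have e := addv_pi1_pi2 xUW.
apply/eqP/idP => [h|xW].
  have p0 : addv_pi1 U W x = 0.
    by rewrite -(vsprojK (pi1_mem U W x)) h linear0.
  by rewrite -e p0 add0r memv_pi2.
apply/eqP; rewrite -(inj_eq subvs_inj) vsprojK ?pi1_mem // linear0.
have : addv_pi1 U W x \in ((U :\: W) :&: W)%VS.
  rewrite memv_cap pi1_mem -[X in X \in W](addrK (addv_pi2 U W x)) e.
  by rewrite rpredB // memv_pi2.
by rewrite capv_diff memv0.
Qed.

Lemma quotv_proj_surj U W (y : quotv U W) :
  exists2 x, x \in U & quotv_proj U W x = y.
Proof.
exists (vsval y); first by rewrite (subvP (diffvSl U W)) // subvsP.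
by rewrite quotv_projE [addv_pi1 _ _ _]daddv_pi_id ?vsvalK ?subvsP ?capv_diff.
Qed.

End Quotient.

Definition quotv_map (F : fieldType) (vT wT : vectType F) (f : 'Hom(vT, wT))
    (U W : {vspace vT}) (U' W' : {vspace wT}) :
    'Hom(quotv U W, quotv U' W') :=
  linfun (fun x : quotv U W => quotv_proj U' W' (f (vsval x))).

Lemma quotv_mapE (F : fieldType) (vT wT : vectType F) (f : 'Hom(vT, wT))
    (U W : {vspace vT}) (U' W' : {vspace wT}) x :
  (W' <= U')%VS -> (f @: U <= U')%VS -> (f @: W <= W')%VS -> x \in U ->
  quotv_map f U W U' W' (quotv_proj U W x) = quotv_proj U' W' (f x).
Proof.
move=> sWU' fU fW xU; rewrite /quotv_map.
have lin : linear (fun x : quotv U W => quotv_proj U' W' (f (vsval x))).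
  by move=> a u v; rewrite !linearP.
pose ml := GRing.isLinear.Build _ _ _ _ _ lin.
pose g : {linear quotv U W -> quotv U' W'} := HB.pack
  (fun x : quotv U W => quotv_proj U' W' (f (vsval x))) ml.
have vpi : vsval (quotv_proj U W x) = addv_pi1 U W x.
  by rewrite quotv_projE; apply: vsprojK; apply: memv_pi.
rewrite (lfunE g) [g _]/= vpi.
have xUW : x \in (U + W)%VS by rewrite (subvP (addvSl _ _)).
apply/eqP; rewrite -subr_eq0 -!linearB quotv_projP //.
  rewrite -[X in _ - X](addv_pi1_pi2 xUW) opprD addrA subrr add0r linearN.
  by rewrite rpredN (subvP fW) // memv_img // memv_pi2.
rewrite (subvP fU) // memv_img // rpredB //.
by rewrite memv_pi1.
Qed.

(* A sequence of finite-dimensional spaces and linear maps. For a sequence with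
   last index m, what happens at indices greater than m is irrelevant. *)
Record pmodule (F : fieldType) := PModule {
  pm_space : nat -> vectType F;
  pm_map : forall k, 'Hom(pm_space k, pm_space k.+1)
}.

Section Barcode.
Variable F : fieldType.
Implicit Types M N : pmodule F.

Definition pm_iso (m : nat) M N : Prop :=
  exists phi : forall k, 'Hom(pm_space M k, pm_space N k),
    (forall k, (k <= m)%N -> bijective (phi k)) /\
    (forall k, (k < m)%N -> forall x,
       phi k.+1 (pm_map M k x) = pm_map N k (phi k x)).

Definition pm_zero : pmodule F :=
  PModule (fun k => linfun (fun u : 'rV[F]_0 => u)).

Definition pm_sum M N : pmodule F :=
  PModule (fun k =>
    linfun (fun u : (pm_space M k * pm_space N k)%type =>
              ((pm_map M k u.1, pm_map N k u.2)
                : (pm_space M k.+1 * pm_space N k.+1)%type))).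

(* The boolean b <= k <= d is used as a dimension, 0 or 1; the map between two
   copies of F is the 1 x 1 matrix 1, i.e. the identity. *)
Definition interval_module (bd : nat * nat) : pmodule F :=
  PModule (fun k =>
    linfun (fun u : 'rV[F]_(bd.1 <= k <= bd.2)%N =>
              u *m (const_mx 1 : 'M[F]_(_, (bd.1 <= k.+1 <= bd.2)%N)))).

Definition is_barcode (m : nat) M (s : seq (nat * nat)) : Prop :=
  all (fun bd => bd.1 <= bd.2 <= m)%N s /\
  pm_iso m M (foldr pm_sum pm_zero (map interval_module s)).

(* A class with interval [b, d] is born at index b and dies on entering index
   d + 1. Only the indices 0, .., m carry a scale: an interval still alive at the
   last index m is closed off at the last scale. *)
Definition is_persistence_diagram (R : realType) (m : nat) (scale : nat -> R) M
    (X : seq (R * R)) : Prop :=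
  exists2 s, is_barcode m M s
    & X = [seq (scale bd.1, scale (minn bd.2.+1 m)) | bd <- s].

End Barcode.

Section Bottleneck.
Variable R : realType.
Implicit Types X Y : seq (R * R).

Definition linf_dist (x y : R * R) : R :=
  Num.max `|x.1 - y.1| `|x.2 - y.2|.

(* A bijection between X and Y, each completed by points of the diagonal with
   arbitrary multiplicities, given by the list of the pairs (x, image of x). As X
   and Y are finite, finitely many diagonal points suffice. *)
Definition is_matching X Y (g : seq ((R * R) * (R * R))) : Prop :=
  exists DX DY : seq (R * R),
    [/\ all (fun x => x.1 == x.2) DX, all (fun y => y.1 == y.2) DY,
        perm_eq (unzip1 g) (X ++ DX) & perm_eq (unzip2 g) (Y ++ DY)].

Definition matching_cost (g : seq ((R * R) * (R * R))) : R :=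
  \big[Num.max/0]_(xy <- g) linf_dist xy.1 xy.2.

Definition bottleneck_distance X Y : \bar R :=
  ereal_inf [set (matching_cost g)%:E | g in [set g | is_matching X Y g]].

End Bottleneck.

(* A simplicial complex with vertices in a finite type T is the set of its
   (nonempty) simplices, in {set {set T}}. *)
Section Homology.
Variable T : finType.
Implicit Types (K : {set {set T}}) (s : {set T}) (f : T -> T).

Definition chain : vectType 'F_2 := {ffun {set T} -> ('F_2)^o}.

Definition chain_of s : chain := [ffun t => (t == s)%:R].

Definition lin_ext (g : {set T} -> chain) : 'Hom(chain, chain) :=
  linfun (fun c : chain => \sum_s c s *: g s).

Lemma lin_extE g s : lin_ext g (chain_of s) = g s.
Proof.
have lin : linear (fun c : chain => \sum_s c s *: g s).
  move=> a u v; rewrite scaler_sumr -big_split; apply: eq_bigr => t _.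
  by rewrite !ffunE scalerDl scalerA.
pose ml := GRing.isLinear.Build _ _ _ _ _ lin.
pose h : {linear chain -> chain} :=
  HB.pack (fun c : chain => \sum_s c s *: g s) ml.
rewrite (lfunE h) /= (bigD1 s) //= ffunE eqxx scale1r big1 ?addr0 // => t ts.
by rewrite ffunE (negPf ts) scale0r.
Qed.

Definition chains K q : {vspace chain} :=
  <<[seq chain_of s | s <- enum K & #|s| == q.+1]>>%VS.

(* Homology is not reduced: the empty face of a vertex is discarded. *)
Definition boundary : 'Hom(chain, chain) :=
  lin_ext (fun s => \sum_(v in s | s :\ v != finset.set0) chain_of (s :\ v)).

Definition cycles K q : {vspace chain} := (chains K q :&: lker boundary)%VS.
Definition boundaries K q : {vspace chain} := (boundary @: chains K q.+1)%VS.

Definition homology K q : vectType 'F_2 := quotv (cycles K q) (boundaries K q).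

Definition chain_map f : 'Hom(chain, chain) :=
  lin_ext (fun s => if #|f @: s| == #|s| then chain_of (f @: s) else 0).

Definition homology_map f K K' q : 'Hom(homology K q, homology K' q) :=
  quotv_map (chain_map f)
    (cycles K q) (boundaries K q) (cycles K' q) (boundaries K' q).

(* f k is the vertex map of a simplicial map from K k to K k.+1; only its values
   on the vertices of K k matter. *)
Definition homology_module (K : nat -> {set {set T}}) (f : nat -> T -> T) q :
    pmodule 'F_2 :=
  @PModule _ (fun k => homology (K k) q)
    (fun k => homology_map (f k) (K k) (K k.+1) q).

Definition skeleton K (p : nat) : {set {set T}} :=
  [set s in K | (#|s| <= p.+1)%N].

End Homology.

Section Metric.
Variable R : realType.

(* Balls are closed, with centers anywhere in M. *)
Definition is_doubling (M : metricType R) (d : R) : Prop :=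
  forall (x : M) (r : R), 0 < r ->
    exists2 s : seq M, (size s)%:R <= 2 `^ d
      & forall y, mdist x y <= r -> exists2 c, c \in s & mdist c y <= r / 2.

Definition doubling_dimension (M : metricType R) (d : R) : Prop :=
  is_doubling M d /\ (forall d', is_doubling M d' -> d <= d').

Variables (M : metricType R) (V : {fset M}).
Implicit Types W : {set V}.

Definition pdist (u v : V) : R := mdist (val u) (val v).

Definition rips (r : R) W : {set {set V}} :=
  [set s : {set V} | [&& s != finset.set0, s \subset W
    & [forall u in s, forall v in s, pdist u v <= r]]].

Definition net_separated (delta : R) W : Prop :=
  {in W &, forall u v, u != v -> delta < pdist u v}.

Definition is_net (delta : R) W' W : Prop :=
  [/\ W' \subset W,
      {in W, forall w, exists2 w', w' \in W' & pdist w w' <= delta}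
    & net_separated delta W'].

(* The radius of the net W k.+1 of W k. The index is an integer because
   net_radius (-1) is the separation that W 0 would have as a term of the same
   sequence of nets; W 0 is the whole V, of which nothing of the sort is known. *)
Definition net_radius (alpha eps : R) (k : int) : R :=
  alpha * eps ^+ 2 / 2 * (1 + eps) ^ (k - 1).

Definition net_sequence (alpha eps : R) (m : nat) (W : nat -> {set V}) : Prop :=
  W 0%N = [set: V] /\
  (forall k, (k < m)%N -> is_net (net_radius alpha eps k%:Z) (W k.+1) (W k)).

(* Ties may be broken arbitrarily, and prj k is unconstrained outside W k. *)
Definition nearest_point_maps (m : nat) (W : nat -> {set V}) (prj : nat -> V -> V)
    : Prop :=
  forall k, (k < m)%N -> {in W k, forall v,
    prj k v \in W k.+1 /\ {in W k.+1, forall w, pdist v (prj k v) <= pdist v w}}.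

Definition rips_scale (alpha eps : R) (k : nat) : R := alpha * (1 + eps) ^+ k.

Definition rips_filtration_homology (alpha eps : R) (q : nat) : pmodule 'F_2 :=
  homology_module (fun k => rips (rips_scale alpha eps k) [set: V])
    (fun _ => id) q.

Definition net_rips_homology (alpha eps : R) (W : nat -> {set V})
    (prj : nat -> V -> V) (q : nat) : pmodule 'F_2 :=
  homology_module (fun k => rips (rips_scale alpha eps k) (W k)) prj q.

Definition log_scale_approximates (alpha eps : R) (m : nat) (c : R)
    (N N' : nat -> pmodule 'F_2) : Prop :=
  forall q (X Y : seq (R * R)),
    is_persistence_diagram m (fun k => ln (rips_scale alpha eps k)) (N q) X ->
    is_persistence_diagram m (fun k => ln (rips_scale alpha eps k)) (N' q) Y ->
    (bottleneck_distance X Y <= c%:E)%E.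

End Metric.

(* Main.v *)
Require Import Defs.
From HB Require Import structures.
From mathcomp Require Import all_boot all_order all_algebra finmap.
From mathcomp Require Import all_classical all_reals all_analysis.
From mathcomp Require Import zify ring lra.

(* Write A_k for the homology of the complex on V_k and B_k for that of the
   complex on V at the same scale. The inclusions A_k -> B_k and the maps
   B_k -> A_{k+1} induced by pi_k ... pi_0 compose to the maps of both sequences:
   the first composite is h_k since pi_{k-1} ... pi_0 fixes V_k, the second is the
   inclusion up to contiguity since the displacements form a geometric series of
   sum at most alpha eps (1 + eps)^k / 2. Hence A and B are the even and odd terms
   of a single sequence A_0 -> B_0 -> A_1 -> B_1 -> ..., whose bars restrict to
   those of A and B with endpoints at most one step apart. The ranks of this
   sequence already determine a list of bars, so that its decomposition into
   intervals is not needed.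

   For the size, V_k is separated by eps^2 / (2 (1 + eps)^2) times the scale, so
   that covering a ball t times by half as large balls, with 2^t about 16 / eps^2,
   bounds the number of neighbours of a vertex by (32 / eps^2)^d. *)

Set Implicit Arguments.
Unset Strict Implicit.
Unset Printing Implicit Defensive.

Import Order.TTheory GRing.Theory Num.Theory.
Local Open Scope ring_scope.

(** * Persistence modules and their ranks *)

Lemma linfunE (F : fieldType) (U V : vectType F) (f : U -> V) :
  linear f -> linfun f =1 f.
Proof.
move=> lin x; pose ml := GRing.isLinear.Build _ _ _ _ _ lin.
pose h : {linear U -> V} := HB.pack f ml.
exact: (lfunE h).
Qed.

Definition bar_count (s : seq (nat * nat)) (i j : nat) : nat :=
  count (fun bd => (bd.1 <= i) && (j <= bd.2))%N s.

Section Ranks.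
Variable F : fieldType.
Implicit Types M N : pmodule F.

(* The image of the space of index i in that of index j, for i <= j. *)
Fixpoint pm_im M (i j : nat) : {vspace pm_space M j} :=
  match j with
  | 0 => fullv
  | j'.+1 => if (j'.+1 <= i)%N then fullv else (pm_map M j' @: pm_im M i j')%VS
  end.

Lemma pm_im_full M i j : (j <= i)%N -> pm_im M i j = fullv.
Proof. by case: j => //= j ->. Qed.

Lemma pm_imS M i j : (i <= j)%N ->
  pm_im M i j.+1 = (pm_map M j @: pm_im M i j)%VS.
Proof. by move=> ij /=; rewrite ltnNge ij. Qed.

(** The isomorphism carries images onto images by commutation with the maps, and dimension survives
    because it is injective. *)
Lemma dim_pm_im_iso m M N i j : pm_iso m M N -> (j <= m)%N ->
  \dim (pm_im M i j) = \dim (pm_im N i j).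
Proof.
move=> [phi [bij comm]] jm.
have -> : pm_im N i j = (phi j @: pm_im M i j)%VS.
  elim: j jm => [|j IH] jm.
    rewrite /=; apply/vspaceP => x; rewrite memvf; have [g _ gK] := bij 0%N isT.
    by rewrite -[x]gK memv_img ?memvf.
  have [ji|ij] := leqP j.+1 i.
    rewrite !pm_im_full //; apply/vspaceP => x; rewrite memvf.
    by have [g _ gK] := bij _ jm; rewrite -[x]gK memv_img ?memvf.
  rewrite !pm_imS // IH ?(ltnW jm) // -!limg_comp; congr (_ @: _)%VS.
  by apply/lfunP => x; rewrite !comp_lfunE comm.
rewrite limg_dim_eq //; apply/eqP; rewrite -subv0; apply/subvP => x.
rewrite memv_cap => /andP[_]; have [g fK _] := bij _ jm.
by have /lker0P/eqP -> := can_inj fK.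
Qed.

Section Sum.
Variables M N : pmodule F.

Let inl k : 'Hom(pm_space M k, pm_space (pm_sum M N) k) :=
  linfun (fun u : pm_space M k => (u, 0) : (pm_space M k * pm_space N k)%type).
Let inr k : 'Hom(pm_space N k, pm_space (pm_sum M N) k) :=
  linfun (fun u : pm_space N k => (0, u) : (pm_space M k * pm_space N k)%type).

Let inlE k u : inl k u = (u, 0) :> (pm_space M k * pm_space N k)%type.
Proof.
by rewrite [LHS]linfunE // => a x y; congr pair; rewrite /= scaler0 addr0.
Qed.

Let inrE k u : inr k u = (0, u) :> (pm_space M k * pm_space N k)%type.
Proof.
by rewrite [LHS]linfunE // => a x y; congr pair; rewrite /= scaler0 addr0.
Qed.

Let sum_mapE k (u : (pm_space M k * pm_space N k)%type) :
  pm_map (pm_sum M N) k u = (pm_map M k u.1, pm_map N k u.2).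
Proof.
by rewrite [LHS]linfunE // => a x y; congr pair; rewrite /= linearP.
Qed.

(** The two injections commute with the maps, so the image in the sum is the sum of the two injected
    images, which meet only in zero. *)
Lemma dim_pm_im_sum i j :
  \dim (pm_im (pm_sum M N) i j) = (\dim (pm_im M i j) + \dim (pm_im N i j))%N.
Proof.
have full k : (inl k @: fullv + inr k @: fullv)%VS = fullv.
  apply/vspaceP => x; rewrite memvf; case: x => a b.
  have -> : (a, b) = inl k a + inr k b :> pm_space (pm_sum M N) k.
    by rewrite inlE inrE; congr pair; rewrite /= ?addr0 ?add0r.
  by apply: memv_add; apply: memv_img; apply: memvf.
have -> : pm_im (pm_sum M N) i j = (inl j @: pm_im M i j + inr j @: pm_im N i j)%VS.
  elim: j => [|j IH]; first by rewrite full.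
  have [ji|ij] := leqP j.+1 i; first by rewrite !pm_im_full // full.
  have eM : (pm_map (pm_sum M N) j \o inl j)%VF = (inl j.+1 \o pm_map M j)%VF.
    apply/lfunP => x; rewrite [LHS]comp_lfunE [RHS]comp_lfunE inlE sum_mapE inlE.
    by rewrite /= linear0.
  have eN : (pm_map (pm_sum M N) j \o inr j)%VF = (inr j.+1 \o pm_map N j)%VF.
    apply/lfunP => x; rewrite [LHS]comp_lfunE [RHS]comp_lfunE inrE sum_mapE inrE.
    by rewrite /= linear0.
  by rewrite !pm_imS // IH limgD -!limg_comp eM eN.
rewrite dimv_disjoint_sum.
  congr (_ + _)%N; apply: limg_dim_eq; apply/eqP; rewrite -subv0; apply/subvP => x.
    rewrite memv_cap memv_ker inlE => /andP[_ /eqP[->]]; exact: mem0v.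
  rewrite memv_cap memv_ker inrE => /andP[_ /eqP[->]]; exact: mem0v.
apply/eqP; rewrite -subv0; apply/subvP => x; rewrite memv_cap.
move=> /andP[/memv_imgP[a _ ->] /memv_imgP[b _]].
by rewrite inlE inrE => -[-> _]; exact: mem0v.
Qed.

End Sum.

Lemma row_mul_const1 (a b : bool) (x : 'rV[F]_b) : a -> b ->
  exists u : 'rV[F]_a, u *m const_mx 1 = x.
Proof.
case: a b x => [] [] // x _ _; exists x; apply/rowP => j.
by rewrite mxE big_ord1 mxE mulr1 !ord1.
Qed.

Lemma dim_pm_im_interval (bd : nat * nat) i j : (i <= j)%N ->
  \dim (pm_im (interval_module F bd) i j) = ((bd.1 <= i) && (j <= bd.2))%N.
Proof.
move=> ij.
have dimE k : \dim (fullv : {vspace pm_space (interval_module F bd) k})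
              = (bd.1 <= k <= bd.2)%N.
  by rewrite dimvf /dim /= mul1n.
have dim0 k (U : {vspace pm_space (interval_module F bd) k}) :
    (bd.1 <= k <= bd.2)%N = false -> \dim U = 0%N.
  by move=> e; apply/eqP; rewrite -leqn0 -[X in (_ <= X)%N]/(nat_of_bool false) -e
    -dimE dimvS // subvf.
rewrite -(subnK ij); elim: (j - i)%N => [|n IH].
  by rewrite add0n pm_im_full // dimE.
rewrite addSn pm_imS ?leq_addl //.
have [e|e] := boolP (bd.1 <= (n + i).+1 <= bd.2)%N; last first.
  rewrite dim0; last exact: negbTE.
  by case: leqP e => //= bi; case: leqP => //; lia.
(* If the bar is born after [i], the induction hypothesis already makes the image zero at index
   [n + i], and the next map cannot enlarge it. *)
have [bi|bi] := leqP bd.1 i; last first.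
  have := limg_ker_dim (pm_map (interval_module F bd) (n + i))
                       (pm_im (interval_module F bd) i (n + i)).
  by rewrite IH leqNgt bi; lia.
have e' : (bd.1 <= n + i <= bd.2)%N by lia.
have imf : pm_im (interval_module F bd) i (n + i) = fullv.
  by apply/eqP; rewrite eqEdim subvf dimE IH; lia.
have -> : (pm_map (interval_module F bd) (n + i)
   @: pm_im (interval_module F bd) i (n + i))%VS = fullv.
  rewrite imf.
  apply/eqP; rewrite eqEsubv subvf; apply/subvP => x _.
  have [u <-] : exists u, pm_map (interval_module F bd) (n + i) u = x.
    have [u ux] := row_mul_const1 x e' e.
    exists u; rewrite [LHS]linfunE //.
    by move=> a y z; rewrite mulmxDl -scalemxAl.
  by rewrite memv_img ?memvf.
by rewrite dimE; lia.
Qed.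

(** Ranks are isomorphism invariants and additive over sums; an interval contributes 1 exactly when
    it contains both [i] and [j]. *)
Lemma dim_pm_im_barcode m M s i j : is_barcode m M s -> (i <= j <= m)%N ->
  \dim (pm_im M i j) = bar_count s i j.
Proof.
move=> [_ iso] /andP[ij jm]; rewrite (dim_pm_im_iso _ iso jm) {iso}.
elim: s => [|bd s IH].
  by apply/eqP; rewrite -leqn0 (leq_trans (dimvS (subvf _))) // dimvf.
apply: etrans (dim_pm_im_sum _ _ _ _) _.
by rewrite dim_pm_im_interval // IH.
Qed.
End Ranks.

(** * Lists of bars and rank functions *)

Section Bars.
Local Open Scope nat_scope.
Implicit Types s : seq (nat * nat).

(** The list has [h 0] copies of 0 and, for each [t < n], the increment [h t.+1 - h t] as the number
    of copies of [t.+1]. *)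
Lemma bars_of_monotone (h : nat -> nat) n :
  {in [pred t | t <= n] &, {homo h : t u / t <= u}} ->
  exists2 l, all (leq^~ n) l & forall t, t <= n -> count (leq^~ t) l = h t.
Proof.
elim: n => [|n IH] mono.
  exists (nseq (h 0) 0) => [|t]; first by rewrite all_nseq orbT.
  by rewrite leqn0 => /eqP ->; rewrite count_nseq mul1n.
have [|l ln lh] := IH.
  by move=> t u; rewrite !inE => tn un; apply: mono; rewrite inE leqW.
have hn : h n <= h n.+1 by apply: mono; rewrite ?inE //=.
exists (l ++ nseq (h n.+1 - h n) n.+1) => [|t].
  rewrite all_cat all_nseq leqnn orbT andbT.
  by apply: sub_all ln => x /leqW.
rewrite leq_eqVlt ltnS => /orP[/eqP ->|tn]; rewrite count_cat count_nseq.
  rewrite leqnn mul1n (_ : count _ l = size l) ?count_size; last first.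
    by apply/eqP; rewrite -all_count; apply: sub_all ln => x /leqW.
  rewrite (_ : size l = h n) ?subnKC // -lh //.
  by apply/esym/eqP; rewrite -all_count.
by rewrite lh // ltnNge tn /= mul0n addn0.
Qed.

(* r t u plays the role of the rank of the map from index t to index u, and
   k t u that of the dimension of the part of its image killed at u.+1. *)
Lemma bars_of_ranks (r k : nat -> nat -> nat) L :
  (forall t t' u, t <= t' <= u -> u <= L -> k t u <= k t' u) ->
  (forall t, t <= L -> r t L = k t L) ->
  (forall t u, t <= u < L -> r t u = k t u + r t u.+1) ->
  exists2 s, all (fun bd => bd.1 <= bd.2 <= L) s
    & forall t u, t <= u <= L -> r t u = bar_count s t u.
Proof.
move=> kmono rL rS.
(* Bars are added by decreasing end: stage [n] has those that end at [L - n] or later, enough to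
   give the ranks into these indices. *)
suff /(_ L (leqnn _)) [s + sr] : forall n, n <= L ->
    exists2 s, all (fun bd => (bd.1 <= bd.2 <= L) && (L - n <= bd.2)) s
    & forall t u, t <= u <= L -> L - n <= u -> r t u = bar_count s t u.
  rewrite subnn => sL; exists s; first by apply: sub_all sL => bd /andP[].
  by move=> t u tu; apply: sr; rewrite ?subnn.
(* The bars that end at [u]: [k t u] is to count those born at or before [t], so their births are
   read off its growth in [t]. *)
have col u : u <= L -> exists2 l, all (leq^~ u) l
    & forall t, t <= u -> count (leq^~ t) l = k t u.
  move=> uL; apply: (@bars_of_monotone (k^~ u)) => t t'; rewrite !inE => tu t'u tt'.
  by apply: kmono => //; rewrite tt'.
have count_col l t u v : u <= v ->
    bar_count [seq (b, v) | b <- l] t u = count (leq^~ t) l.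
  by move=> uv; rewrite /bar_count count_map; apply: eq_count => b /=; rewrite uv andbT.
elim=> [|n IH] nL.
  have [l lL lk] := col L (leqnn _).
  exists [seq (b, L) | b <- l].
    by rewrite all_map; apply: sub_all lL => b /= ->; rewrite leqnn leq_subr.
  move=> t u /andP[tu uL]; rewrite subn0 => Lu.
  have -> : u = L by apply/eqP; rewrite eqn_leq uL.
  by rewrite count_col // lk ?rL // (leq_trans tu).
have [s sL sr] := IH (ltnW nL); set v := L - n.+1.
have [l lv lk] := col v (leq_subr _ _).
exists ([seq (b, v) | b <- l] ++ s).
  rewrite all_cat all_map; apply/andP; split.
    by apply: sub_all lv => b /= ->; rewrite leqnn leq_subr.
  by apply: sub_all sL => bd; rewrite /v; lia.
move=> t u /andP[tu uL] vu; rewrite /bar_count count_cat -!/(bar_count _ _ _).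
have [e|uv] := eqVneq u v.
  rewrite e count_col // lk -?e // rS; last by rewrite tu e /v; lia.
  rewrite e; congr (_ + _).
  (* The bars already in [s] end after [v], so as many of them reach [v] as reach [v.+1]. *)
  rewrite sr; last by rewrite /v; lia.
    apply: eq_in_count => bd bds /=; congr (_ && _).
    by move: (allP sL _ bds); rewrite /v; lia.
  by rewrite /v; move: tu; rewrite e /v; lia.
have -> : bar_count [seq (b, v) | b <- l] t u = 0.
  apply/eqP; rewrite -leqn0 leqNgt -has_count; apply/hasPn => bd /mapP[b _ ->] /=.
  by rewrite negb_and -!ltnNge; apply/orP; right; lia.
by rewrite add0n sr //; rewrite ?tu //; move: vu uv; rewrite /v; lia.
Qed.

(** By inclusion-exclusion, the multiplicity of a bar is an alternating sum of four values of
    [bar_count]. *)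
Lemma perm_eq_bars m s s' :
  all (fun bd => bd.1 <= bd.2 <= m) s -> all (fun bd => bd.1 <= bd.2 <= m) s' ->
  (forall i j, i <= j <= m -> bar_count s i j = bar_count s' i j) ->
  perm_eq s s'.
Proof.
move=> sm s'm e.
(* The strict inequality shifts the birth index: [C x i.+1 j] is [bar_count x i j], and [C x 0 j] is
   zero, so that births at 0 are no special case. *)
pose C (x : seq (nat * nat)) i j := count (fun bd => (bd.1 < i) && (j <= bd.2)) x.
have C0 x j : C x 0 j = 0 by rewrite /C count_pred0.
have Cm x i : all (fun bd => bd.1 <= bd.2 <= m) x -> C x i m.+1 = 0.
  move=> xm; apply/eqP; rewrite -leqn0 leqNgt -has_count; apply/hasPn => bd bdx.
  by move: (allP xm _ bdx); lia.
have CE i j : i <= j.+1 -> j <= m.+1 -> C s i j = C s' i j.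
  case: i => [|i] ij; first by rewrite !C0.
  rewrite leq_eqVlt => /orP[/eqP -> | jm]; first by rewrite !Cm.
  by apply: e; rewrite -ltnS ij.
have incl b d x : count_mem (b, d) x + C x b d + C x b.+1 d.+1
    = C x b.+1 d + C x b d.+1.
  rewrite /C; elim: x => //= -[b' d'] x IH /=; rewrite xpair_eqE.
  by move: IH; case: eqP; case: eqP; lia.
apply/allP => -[b d]; rewrite mem_cat => bd /=.
have {bd}bdm : b <= d <= m.
  by case/orP: bd => bd; [move: (allP sm _ bd)|move: (allP s'm _ bd)].
have := incl b d s; rewrite !CE; try lia.
by rewrite -(incl b d s') => /addIn/addIn ->.
Qed.

End Bars.

(** * Two modules as the even and odd terms of one sequence *)

Section Zigzag.
Variables (F : fieldType) (A B : pmodule F) (m : nat).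
Variable phi : forall k, 'Hom(pm_space A k, pm_space B k).
Variable psi : forall k, 'Hom(pm_space B k, pm_space A k.+1).
Hypothesis psi_phi :
  forall k, (k < m)%N -> forall x, pm_map A k x = psi k (phi k x).
Hypothesis phi_psi :
  forall k, (k < m)%N -> forall x, pm_map B k x = phi k.+1 (psi k x).

(* In the sequence A 0 -> B 0 -> A 1 -> B 1 -> ..., where A j has index 2j and
   B j index 2j + 1, the images in A j and B j of the space of index t. *)
Fixpoint zig_imA (t j : nat) : {vspace pm_space A j} :=
  match j with
  | 0 => fullv
  | j'.+1 => if (j'.+1.*2 <= t)%N then fullv else
      (psi j' @: (if (j'.*2 < t)%N then fullv else phi j' @: zig_imA t j'))%VS
  end.

Definition zig_imB (t j : nat) : {vspace pm_space B j} :=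
  if (j.*2 < t)%N then fullv else (phi j @: zig_imA t j)%VS.

Lemma zig_imAS t j : (t <= j.*2.+1)%N ->
  zig_imA t j.+1 = (psi j @: zig_imB t j)%VS.
Proof. by move=> tj; rewrite /= doubleS ltnNge tj. Qed.

Lemma zig_imA_full t j : (j.*2 <= t)%N -> zig_imA t j = fullv.
Proof. by case: j => //= j ->. Qed.

Lemma zig_imB_full t j : (j.*2 < t)%N -> zig_imB t j = fullv.
Proof. by rewrite /zig_imB => ->. Qed.

Lemma zig_imBE t j : (t <= j.*2)%N -> zig_imB t j = (phi j @: zig_imA t j)%VS.
Proof. by move=> tj; rewrite /zig_imB ltnNge tj. Qed.

(** What comes from index [t] passes through index [t'] on its way. *)
Lemma zig_im_mono t t' j : (t <= t')%N ->
  (zig_imA t j <= zig_imA t' j)%VS /\ (zig_imB t j <= zig_imB t' j)%VS.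
Proof.
move=> tt'.
have AB i : (zig_imA t i <= zig_imA t' i)%VS -> (zig_imB t i <= zig_imB t' i)%VS.
  move=> s; have [ti|it] := leqP t' i.*2; last by rewrite (zig_imB_full it) subvf.
  by rewrite !zig_imBE ?limgS // (leq_trans tt').
suff sA : (zig_imA t j <= zig_imA t' j)%VS by split=> //; apply: AB.
elim: j => [|j IH]; first exact: subvf.
have [tj|jt] := leqP t' j.*2.+1; last by rewrite (@zig_imA_full t') ?subvf.
by rewrite !zig_imAS ?limgS ?AB // (leq_trans tt').
Qed.

Lemma zig_imA_even i j : (j <= m)%N -> zig_imA i.*2 j = pm_im A i j.
Proof.
elim: j => // j IH jm; have [ji|ij] := leqP j.+1 i.
  by rewrite pm_im_full // zig_imA_full // leq_double.
rewrite zig_imAS ?zig_imBE ?leq_double ?(leqW, leq_double) // IH ?(ltnW jm) //.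
rewrite pm_imS // -limg_comp; congr (_ @: _)%VS.
by apply/lfunP => x; rewrite comp_lfunE psi_phi.
Qed.

Lemma zig_imB_odd i j : (j <= m)%N -> zig_imB i.*2.+1 j = pm_im B i j.
Proof.
elim: j => [|j IH] jm; first exact: zig_imB_full.
have [ji|ij] := leqP j.+1 i.
  by rewrite pm_im_full // zig_imB_full // ltnS leq_double.
rewrite zig_imBE; last by rewrite doubleS !ltnS leqW // leq_double.
rewrite zig_imAS ?ltnS ?leq_double // IH ?(ltnW jm) //.
rewrite pm_imS // -limg_comp; congr (_ @: _)%VS.
by apply/lfunP => x; rewrite comp_lfunE phi_psi.
Qed.

(** The ranks of the merged sequence satisfy the hypotheses of [bars_of_ranks]: the recursion is
    rank-nullity, the monotonicity that of the images. *)
Lemma zigzag_bars : exists2 s : seq (nat * nat),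
    all (fun bd => bd.1 <= bd.2 <= m.*2.+1)%N s
  & forall i j, (i <= j <= m)%N ->
      \dim (pm_im A i j) = bar_count s i.*2 j.*2 /\
      \dim (pm_im B i j) = bar_count s i.*2.+1 j.*2.+1.
Proof.
pose r t u := if odd u then \dim (zig_imB t u./2) else \dim (zig_imA t u./2).
(* At the last index everything still alive counts as killed. *)
pose k t u := if (u < m.*2.+1)%N then
    if odd u then \dim (zig_imB t u./2 :&: lker (psi u./2))
    else \dim (zig_imA t u./2 :&: lker (phi u./2))
  else r t u.
have parity u : u = u./2.*2 \/ u = u./2.*2.+1.
  by have := odd_double_half u; case: odd => /= <-; rewrite ?add1n ?add0n; [right|left];
     rewrite /= ?uphalf_double ?doubleK.
have [|||s sm sr] := @bars_of_ranks r k m.*2.+1.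
- move=> t t' u /andP[tt' _] _; have [sA sB] := zig_im_mono u./2 tt'.
  by rewrite /k /r; case: ifP => _; case: ifP => _; apply: dimvS => //; apply: capvS.
- by move=> t _; rewrite /k ltnn.
- move=> t u /andP[tu um]; rewrite /k um /r.
  case: (parity u) => e; move: tu; rewrite e; set j := u./2.
    rewrite /= odd_double uphalf_double doubleK => tj.
    by rewrite zig_imBE // limg_ker_dim.
  rewrite /= negbK odd_double uphalf_double doubleK => tj.
  by rewrite doubleS ltnNge tj /= -/(zig_imB t j) limg_ker_dim.
exists s => // i j /andP[ij jm]; split.
  rewrite -sr; last by rewrite leq_double ij leqW // leq_double.
  by rewrite /r odd_double doubleK zig_imA_even.
rewrite -sr; last by rewrite !ltnS !leq_double ij.
by rewrite /r /= odd_double uphalf_double zig_imB_odd.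
Qed.

(** The even indices [2j] in [[b, d]] are those with [j] from [uphalf b] to [d./2], the odd indices
    [2j + 1] those with [j] from [b./2] to [(uphalf d).-1]. The filters discard bars that contain no
    index of the parity concerned; [perm_eq_bars] then identifies the barcodes. *)
Lemma zigzag_barcodes sA sB : is_barcode m A sA -> is_barcode m B sB ->
  exists s : seq (nat * nat),
  [/\ all (fun bd => bd.1 <= bd.2)%N s,
   perm_eq sA [seq (uphalf bd.1, bd.2./2) | bd <- s & (uphalf bd.1 <= bd.2./2)%N] &
   perm_eq sB [seq (bd.1./2, (uphalf bd.2).-1) | bd <- s & (bd.1./2 < uphalf bd.2)%N]].
Proof.
move=> bA bB; have [s sm sr] := zigzag_bars.
exists s; split.
- by apply: sub_all sm => bd /andP[].
- apply: (@perm_eq_bars m); first by case: bA.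
    apply/allP => _ /mapP[bd + ->]; rewrite mem_filter /= => /andP[-> /(allP sm)].
    by lia.
  move=> i j ijm; rewrite -(dim_pm_im_barcode bA) // (sr _ _ ijm).1.
  rewrite /bar_count count_map count_filter; apply: eq_in_count => bd bds /=.
  by move: (allP sm _ bds) ijm; lia.
apply: (@perm_eq_bars m); first by case: bB.
  apply/allP => _ /mapP[bd + ->]; rewrite mem_filter /= => /andP[+ /(allP sm)].
  by lia.
move=> i j ijm; rewrite -(dim_pm_im_barcode bB) // (sr _ _ ijm).2.
rewrite /bar_count count_map count_filter; apply: eq_in_count => bd bds /=.
by move: (allP sm _ bds) ijm; lia.
Qed.

(** * From common bars to a matching of diagrams *)

Section Matching.
Variables (R : realType) (scale : nat -> R) (c : R).
Hypothesis scale_step : forall k, `|scale k.+1 - scale k| <= c.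

Lemma scale_near i j : (i <= j.+1)%N -> (j <= i.+1)%N ->
  `|scale (minn i m) - scale (minn j m)| <= c.
Proof.
have c0 : 0 <= c by apply: le_trans (scale_step 0).
move=> ij ji; have : (minn i m = minn j m \/ minn i m = (minn j m).+1
  \/ minn j m = (minn i m).+1)%N by lia.
by case=> [->|[->|->]]; rewrite ?subrr ?normr0 // distrC.
Qed.

(* Each bar of the zigzag gives a bar of A and a bar of B; one of the two may be
   empty, and its endpoints then define a point of the diagonal. *)
Lemma zigzag_bottleneck X Y : is_persistence_diagram m scale A X ->
  is_persistence_diagram m scale B Y -> (bottleneck_distance X Y <= c%:E)%E.
Proof.
move=> [sA bA ->] [sB bB ->]; have [s [sm pA pB]] := zigzag_barcodes bA bB.
have c0 : 0 <= c by apply: le_trans (scale_step 0).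
(* A death is recorded one index after the end of the bar, hence [(bd.2./2).+1] for [A] and
   [uphalf bd.2] for [B]. These differ by at most one, as do the births. *)
pose ptA (bd : nat * nat) :=
  (scale (minn (uphalf bd.1) m), scale (minn (bd.2./2).+1 m)).
pose ptB (bd : nat * nat) :=
  (scale (minn bd.1./2 m), scale (minn (uphalf bd.2) m)).
pose g := [seq (ptA bd, ptB bd) | bd <- s].
have cost : matching_cost g <= c.
  rewrite /matching_cost big_map; elim/big_rec: _ => // bd x _ xc.
  by rewrite ge_max xc andbT /linf_dist ge_max !scale_near //=; lia.
apply: (@le_trans _ _ (matching_cost g)%:E); last by rewrite lee_fin.
apply: ereal_inf_lbound; exists g => //=.
exists [seq ptA bd | bd <- s & ~~ (uphalf bd.1 <= bd.2./2)%N].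
exists [seq ptB bd | bd <- s & ~~ (bd.1./2 < uphalf bd.2)%N].
have split (p : pred (nat * nat)) (pt : nat * nat -> R * R) (sX : seq (nat * nat))
   (bar : nat * nat -> nat * nat) :
  all (fun bd => bd.1 <= bd.2 <= m)%N sX ->
  perm_eq sX [seq bar bd | bd <- s & p bd] ->
  (forall bd, p bd -> (bar bd).1 <= m ->
     (scale (bar bd).1, scale (minn (bar bd).2.+1 m)) = pt bd)%N ->
  perm_eq [seq pt bd | bd <- s]
    ([seq (scale bd.1, scale (minn bd.2.+1 m)) | bd <- sX]
       ++ [seq pt bd | bd <- s & ~~ p bd]).
  move=> sXm ps ptE.
  have -> : [seq pt bd | bd <- s & ~~ p bd] = map pt (seq.filter (predC p) s) by [].
  apply: (@perm_trans _ (map pt (seq.filter p s ++ seq.filter (predC p) s))).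
    by apply: perm_map; rewrite perm_sym perm_filterC.
  rewrite map_cat perm_cat2r perm_sym.
  apply: perm_trans (perm_map _ ps) _; rewrite -map_comp.
  rewrite (_ : map _ _ = map pt (seq.filter p s)) //.
  apply/eq_in_map => bd bds /=; rewrite ptE //.
    by move: bds; rewrite mem_filter => /andP[].
  suff : bar bd \in sX by move=> /(allP sXm); lia.
  by rewrite (perm_mem ps) map_f.
split.
(* A bar without even index is a single odd index, whose two endpoints for [A] coincide; likewise
   below with the parities exchanged. *)
- apply/allP => _ /mapP[bd + ->]; rewrite mem_filter => /andP[h /(allP sm) bs] /=.
  by apply/eqP; congr (scale _); lia.
- apply/allP => _ /mapP[bd + ->]; rewrite mem_filter => /andP[h /(allP sm) bs] /=.
  by apply/eqP; congr (scale _); lia.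
- rewrite /unzip1 -map_comp; apply: split pA _; first by case: bA.
  by move=> bd /= h bm; rewrite /ptA (minn_idPl bm).
- rewrite /unzip2 -map_comp; apply: split pB _; first by case: bB.
  move=> bd /= h bm; rewrite /ptB (minn_idPl bm) prednK //.
  by apply: leq_ltn_trans h.
Qed.

End Matching.
End Zigzag.

(** * Simplicial homology *)

(* The library's linear0, linearD and linear_sum, stated on 'Hom: with those,
   unification unfolds the vector space structure of chains. *)
Lemma lfun0 (F : fieldType) (U V : vectType F) (A : 'Hom(U, V)) : A 0 = 0.
Proof. exact: linear0. Qed.

Lemma lfunD (F : fieldType) (U V : vectType F) (A : 'Hom(U, V)) a b :
  A (a + b) = A a + A b.
Proof. exact: linearD. Qed.

Lemma lfun_sum (F : fieldType) (U V : vectType F) (A : 'Hom(U, V))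
    (I : finType) (P : pred I) (u : I -> U) :
  A (\sum_(i | P i) u i) = \sum_(i | P i) A (u i).
Proof. exact: linear_sum. Qed.

Section Chains.
Variable T : finType.
Implicit Types (s t : {set T}) (f g : T -> T) (v w : T) (K : {set {set T}}).

Lemma addcc (c : chain T) : c + c = 0.
Proof.
apply/ffunP => s; rewrite !ffunE.
by case: (c s) => [[|[|]]] // ?; apply: val_inj.
Qed.

(** The coefficients are 0 or 1, so closure under scaling need not be assumed. *)
Lemma chain_span (P : chain T -> Prop) :
  P 0 -> (forall a b, P a -> P b -> P (a + b)) ->
  (forall s, P (chain_of s)) -> forall c, P c.
Proof.
move=> P0 PD Ps c.
have -> : c = \sum_s c s *: chain_of s.
  apply/ffunP => t; rewrite sum_ffunE (bigD1 t) //= [X in _ = X + _]ffunE.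
  rewrite ffunE eqxx big1 ?addr0.
    by rewrite -[LHS]mulr1.
  by move=> s st; rewrite !ffunE eq_sym (negPf st) scaler0.
apply: big_ind => // s _; case: (c s) => [[|[|]]] // i.
  by rewrite [Ordinal _](_ : _ = 0) ?scale0r//; apply: val_inj.
by rewrite [Ordinal _](_ : _ = 1) ?scale1r//; apply: val_inj.
Qed.

Lemma eq_lin (A B : 'Hom(chain T, chain T)) :
  (forall s, A (chain_of s) = B (chain_of s)) -> forall c, A c = B c.
Proof.
move=> e; apply: (@chain_span (fun c => A c = B c)) => [|a b ha hb|//].
  by rewrite !lfun0.
by rewrite !lfunD ha hb.
Qed.

(* The boundary map of the augmented complex, which keeps the empty face. *)
Definition aug_boundary : 'Hom(chain T, chain T) :=
  lin_ext (fun s => \sum_(v in s) chain_of (s :\ v)).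

(** Chains, with the empty face as unit, form the exterior algebra on [T] over the field with two
    elements. This is the product by [w]; [chain_map] is multiplicative and [aug_boundary] is a
    derivation. *)
Definition cone w : 'Hom(chain T, chain T) :=
  lin_ext (fun s => if w \in s then 0 else chain_of (w |: s)).

Definition drop_empty : 'Hom(chain T, chain T) :=
  lin_ext (fun s => if s == finset.set0 then 0 else chain_of s).

Lemma chain_mapE f s :
  chain_map f (chain_of s) = if #|f @: s| == #|s| then chain_of (f @: s) else 0.
Proof. exact: lin_extE. Qed.

Lemma boundary_chainE s : boundary T (chain_of s) =
  \sum_(v in s | s :\ v != finset.set0) chain_of (s :\ v).
Proof. exact: lin_extE. Qed.

Lemma aug_boundaryE s :
  aug_boundary (chain_of s) = \sum_(v in s) chain_of (s :\ v).
Proof. exact: lin_extE. Qed.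

Lemma cone_chainE w s :
  cone w (chain_of s) = if w \in s then 0 else chain_of (w |: s).
Proof. exact: lin_extE. Qed.

Lemma drop_emptyE s :
  drop_empty (chain_of s) = if s == finset.set0 then 0 else chain_of s.
Proof. exact: lin_extE. Qed.

(* Otherwise a rewrite that fails to match unfolds chains down to matrices. *)
#[local] Opaque chain_of chain_map boundary aug_boundary cone drop_empty.

Lemma coneE v s : v \in s -> chain_of s = cone v (chain_of (s :\ v)).
Proof. by move=> vs; rewrite cone_chainE finset.setD11 finset.setD1K. Qed.

(** The Leibniz rule for the product by [w]. *)
Lemma aug_boundary_cone w c :
  aug_boundary (cone w c) = c + cone w (aug_boundary c).
Proof.
suff : (aug_boundary \o cone w)%VF c = (\1 + (cone w \o aug_boundary))%VF c.
  by rewrite add_lfunE id_lfunE !comp_lfunE.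
apply: eq_lin => s {c}; rewrite add_lfunE id_lfunE !comp_lfunE /=.
rewrite aug_boundaryE cone_chainE lfun_sum /=.
case: ifPn => ws.
  (* Only the face opposite to [w] survives the cone; it gives back [s], which cancels against the
     first term. *)
  rewrite lfun0 (bigD1 w) //= cone_chainE finset.setD11 finset.setD1K //.
  rewrite big1 ?addr0 ?addcc //.
  by move=> v /andP[vs vw]; rewrite cone_chainE finset.in_setD1 eq_sym vw ws.
rewrite aug_boundaryE big_setU1 //= finset.setU1K //; congr (_ + _).
apply: eq_bigr => v vs; rewrite cone_chainE finset.in_setD1 (negPf ws) andbF.
congr chain_of; apply/finset.setP => x; rewrite !inE.
case: (x =P w) => [->|] //=; case: (w =P v) => // e; by rewrite e vs in ws.
Qed.

Lemma chain_map_cone f w c : chain_map f (cone w c) = cone (f w) (chain_map f c).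
Proof.
suff : (chain_map f \o cone w)%VF c = (cone (f w) \o chain_map f)%VF c.
  by rewrite !comp_lfunE.
apply: eq_lin => s {c}; rewrite !comp_lfunE.
rewrite [X in chain_map f X]cone_chainE [X in cone _ X]chain_mapE.
case: ifPn => ws.
  rewrite lfun0; case: ifP => _; rewrite ?lfun0 // cone_chainE.
  by rewrite imset_f.
rewrite chain_mapE imsetU1 !cardsU1 ws add1n.
case: (boolP (f w \in f @: s)) => fw /=.
  rewrite add0n; case: ifP => [/eqP e|_].
    by have := leq_imset_card f s; rewrite [#|f @: s|]e ltnn.
  by case: ifP; rewrite ?lfun0 // cone_chainE fw.
by rewrite add1n eqSS; case: ifP; rewrite ?lfun0 // cone_chainE (negPf fw).
Qed.

(** Together with [coneE], this reduces identities on simplices to the rules for cones and avoids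
    double sums over faces. *)
Lemma set_cone_ind (P : {set T} -> Prop) :
  P finset.set0 -> (forall v s, v \in s -> P (s :\ v) -> P s) -> forall s, P s.
Proof.
move=> P0 PS s; elim: {s}#|s| {-2}s (leqnn #|s|) => [s|n IH s sn].
  by rewrite leqn0 cards_eq0 => /eqP->.
have [->//|[v vs]] := finset.set_0Vmem s.
by apply: (PS v) => //; apply: IH; rewrite (cardsD1 v) vs in sn.
Qed.

Lemma aug_boundary0 : aug_boundary (chain_of finset.set0) = 0.
Proof. by rewrite aug_boundaryE big_set0. Qed.

Lemma chain_map_aug_boundary f c :
  aug_boundary (chain_map f c) = chain_map f (aug_boundary c).
Proof.
suff : (aug_boundary \o chain_map f)%VF c = (chain_map f \o aug_boundary)%VF c.
  by rewrite !comp_lfunE.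
apply: eq_lin => s {c}; rewrite !comp_lfunE; move: s; apply: set_cone_ind.
  by rewrite chain_mapE imset0 eqxx aug_boundary0 lfun0.
move=> v s vs IH; rewrite (coneE vs) chain_map_cone !aug_boundary_cone IH.
by rewrite lfunD chain_map_cone.
Qed.

Lemma aug_boundaryK c : aug_boundary (aug_boundary c) = 0.
Proof.
suff : (aug_boundary \o aug_boundary)%VF c = (0 : 'Hom(chain T, chain T)) c.
  by rewrite comp_lfunE [RHS]zero_lfunE.
apply: eq_lin => s {c}; rewrite !comp_lfunE [RHS]zero_lfunE; move: s; apply: set_cone_ind.
  by rewrite aug_boundary0 lfun0.
move=> v s vs IH; rewrite (coneE vs) aug_boundary_cone lfunD.
by rewrite aug_boundary_cone IH lfun0 addr0 addcc.
Qed.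

(** This transfers identities from the augmented complex, where the rules for cones hold without
    exception. *)
Lemma boundaryE c : boundary T c = drop_empty (aug_boundary c).
Proof.
suff : boundary T c = (drop_empty \o aug_boundary)%VF c by rewrite comp_lfunE.
apply: eq_lin => s {c}; rewrite [RHS]comp_lfunE [LHS]boundary_chainE.
rewrite [X in drop_empty X]aug_boundaryE lfun_sum big_mkcondr /=.
by apply: eq_bigr => v _; rewrite drop_emptyE; case: eqP.
Qed.

Lemma aug_boundary_drop c : aug_boundary (drop_empty c) = aug_boundary c.
Proof.
suff : (aug_boundary \o drop_empty)%VF c = aug_boundary c by rewrite comp_lfunE.
apply: eq_lin => s {c}; rewrite comp_lfunE drop_emptyE.
by case: eqP => // ->; rewrite lfun0 aug_boundary0.
Qed.

Lemma chain_map_drop f c : chain_map f (drop_empty c) = drop_empty (chain_map f c).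
Proof.
suff : (chain_map f \o drop_empty)%VF c = (drop_empty \o chain_map f)%VF c.
  by rewrite !comp_lfunE.
apply: eq_lin => s {c}; rewrite !comp_lfunE.
rewrite [X in chain_map f X]drop_emptyE [X in drop_empty X]chain_mapE.
have [->|sn0] := eqVneq s finset.set0.
  by rewrite imset0 eqxx lfun0 drop_emptyE eqxx.
by rewrite chain_mapE; case: ifP; rewrite ?lfun0 // drop_emptyE imset_eq0 (negPf sn0).
Qed.

Lemma boundaryK c : boundary T (boundary T c) = 0.
Proof.
rewrite [X in boundary T X]boundaryE [LHS]boundaryE aug_boundary_drop.
by rewrite aug_boundaryK lfun0.
Qed.

Lemma chain_map_boundary f c :
  boundary T (chain_map f c) = chain_map f (boundary T c).
Proof.
by rewrite [LHS]boundaryE [X in _ = chain_map f X]boundaryE chain_map_aug_boundary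
  -chain_map_drop.
Qed.

End Chains.

#[local] Opaque chain_of chain_map boundary aug_boundary cone drop_empty.

(** * Induced maps and contiguity *)

Section Homotopy.
Variable T : finType.
Implicit Types (s t : {set T}) (f g : T -> T) (v w : T) (K : {set {set T}}).

Definition face_closed K :=
  forall s t, s \in K -> t \subset s -> t != finset.set0 -> t \in K.

Definition simplicial f K K' := forall s, s \in K -> f @: s \in K'.

Lemma mem_chains K q s : s \in K -> #|s| = q.+1 -> chain_of s \in chains K q.
Proof.
move=> sK sq; apply: memv_span; apply/mapP; exists s => //.
by rewrite mem_filter sq eqxx mem_enum.
Qed.

Lemma chains_image (A : 'Hom(chain T, chain T)) K q (U : {vspace chain T}) :
  (forall s, s \in K -> #|s| = q.+1 -> A (chain_of s) \in U) ->
  forall c, c \in chains K q -> A c \in U.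
Proof.
move=> AU c; rewrite memv_preim; apply: subvP; apply/span_subvP => _ /mapP[s + ->].
by rewrite mem_filter mem_enum -memv_preim => /andP[/eqP sq sK]; apply: AU.
Qed.

Lemma eq_lin_chains (A B : 'Hom(chain T, chain T)) K q :
  (forall s, s \in K -> #|s| = q.+1 -> A (chain_of s) = B (chain_of s)) ->
  forall c, c \in chains K q -> A c = B c.
Proof.
move=> AB c cK; apply/eqP; rewrite -subr_eq0 -opp_lfunE -add_lfunE -memv0.
apply: (chains_image _ cK) => s sK sq.
by rewrite add_lfunE opp_lfunE AB // subrr memv0.
Qed.

Lemma chain_map_chains f K K' q c : simplicial f K K' ->
  c \in chains K q -> chain_map f c \in chains K' q.
Proof.
move=> fK; apply: chains_image => s sK sq; rewrite chain_mapE.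
by case: eqP => [e|_]; rewrite ?mem0v // mem_chains ?fK // e.
Qed.

Lemma boundary_chains K q c : face_closed K ->
  c \in chains K q.+1 -> boundary T c \in chains K q.
Proof.
move=> cK; apply: chains_image => s sK sq; rewrite boundary_chainE.
apply: rpred_sum => v /andP[vs sv]; apply: mem_chains.
  by apply: (cK s) => //; apply: subD1set.
by move: sq; rewrite (cardsD1 v) vs add1n => -[].
Qed.

Lemma drop_empty_chains K q c : c \in chains K q -> drop_empty T c = c.
Proof.
rewrite -[X in _ = X]id_lfunE; apply: eq_lin_chains => s _ sq.
by rewrite id_lfunE drop_emptyE -cards_eq0 sq.
Qed.

Lemma cycles_chains K q c : c \in cycles K q -> c \in chains K q.
Proof. by rewrite memv_cap => /andP[]. Qed.

Lemma cycles_boundary K q c : c \in cycles K q -> boundary T c = 0.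
Proof. by rewrite memv_cap memv_ker => /andP[_ /eqP]. Qed.

Lemma boundaries_cycles K q : face_closed K -> (boundaries K q <= cycles K q)%VS.
Proof.
move=> cK; apply/subvP => _ /memv_imgP[c cc ->].
by rewrite memv_cap boundary_chains //= memv_ker boundaryK.
Qed.

Lemma chain_map_cycles f K K' q c : simplicial f K K' ->
  c \in cycles K q -> chain_map f c \in cycles K' q.
Proof.
move=> fK cc; rewrite memv_cap (chain_map_chains fK) ?cycles_chains //=.
by rewrite memv_ker chain_map_boundary (cycles_boundary cc) lfun0.
Qed.

Lemma chain_map_boundaries f K K' q c : simplicial f K K' ->
  c \in boundaries K q -> chain_map f c \in boundaries K' q.
Proof.
move=> fK /memv_imgP[b bK ->]; rewrite -chain_map_boundary.
by apply/memv_img/(chain_map_chains fK).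
Qed.

Definition hclass K q (c : chain T) : homology K q :=
  quotv_proj (cycles K q) (boundaries K q) c.

Lemma hclass_surj K q (x : homology K q) :
  exists2 c, c \in cycles K q & hclass K q c = x.
Proof. exact: quotv_proj_surj. Qed.

Lemma homology_mapE f K K' q c : face_closed K' -> simplicial f K K' ->
  c \in cycles K q ->
  homology_map f K K' q (hclass K q c) = hclass K' q (chain_map f c).
Proof.
move=> cK' fK; apply: quotv_mapE; first exact: boundaries_cycles.
  by apply/subvP => _ /memv_imgP[x xK ->]; apply: chain_map_cycles xK.
by apply/subvP => _ /memv_imgP[x xK ->]; apply: chain_map_boundaries xK.
Qed.

Lemma hclass_eq K q a b : face_closed K -> a \in cycles K q ->
  b \in cycles K q -> a + b \in boundaries K q -> hclass K q a = hclass K q b.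
Proof.
move=> cK aK bK ab; apply/eqP; rewrite -subr_eq0 -linearB.
have -> : a - b = a + b.
  by congr (_ + _); apply/eqP; rewrite eq_sym -addr_eq0 addcc.
by rewrite quotv_projP ?boundaries_cycles // rpredD.
Qed.

Lemma addcK (x y z : chain T) : x + z = (x + y) + (y + z).
Proof. by rewrite addrA -(addrA x) addcc addr0. Qed.

Section Prism.
Variables (f g : T -> T) (v : T).
Hypothesis fg : forall w, w != v -> f w = g w.

(** The chain homotopy from [f] to [g]. As they differ only at [v], the prism over a simplex has at
    most one nondegenerate piece, spanned by its image under [f] and [g v]. *)
Definition prism : 'Hom(chain T, chain T) :=
  lin_ext (fun s => if v \in s then cone (g v) (chain_map f (chain_of s)) else 0).

Lemma prismE s : prism (chain_of s) =
  if v \in s then cone (g v) (chain_map f (chain_of s)) else 0.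
Proof. exact: lin_extE. Qed.

#[local] Opaque prism.

Lemma prism_cone c : prism (cone v c) = cone (g v) (chain_map f (cone v c)).
Proof.
suff : (prism \o cone v)%VF c = (cone (g v) \o (chain_map f \o cone v))%VF c.
  by rewrite !comp_lfunE.
apply: eq_lin => s {c}; rewrite !comp_lfunE.
(* The formula holds only on simplices that contain [v]; a cone with apex [v] is such a simplex or
   zero. *)
have key (y : chain T) : y = 0 \/ (exists2 t : {set T}, v \in t & y = chain_of t) ->
    prism y = cone (g v) (chain_map f y).
  case=> [->|[t vt ->]]; last by rewrite [LHS]prismE vt.
  rewrite [LHS]lfun0; apply/esym.
  exact: etrans (congr1 (cone (g v)) (lfun0 (chain_map f))) (lfun0 _).
apply: key; rewrite cone_chainE.
by case: ifP => _; [left|right; exists (v |: s); rewrite ?setU11].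
Qed.

Lemma prism_drop c : prism (drop_empty T c) = prism c.
Proof.
suff : (prism \o drop_empty T)%VF c = prism c by rewrite comp_lfunE.
apply: eq_lin => s {c}; rewrite comp_lfunE drop_emptyE.
by case: eqP => // ->; rewrite lfun0 prismE finset.in_set0.
Qed.

Lemma chain_map_agree s : v \notin s ->
  chain_map f (chain_of s) = chain_map g (chain_of s).
Proof.
move=> vs; rewrite [LHS]chain_mapE [RHS]chain_mapE (_ : f @: s = g @: s) //.
by apply: eq_in_imset => w ws; apply: fg; apply: contraNneq vs => <-.
Qed.

(** For [s] the cone from [v] over a face [t], the Leibniz rule yields [chain_map f s] plus terms
    that cancel except for the cone from [g v] over [chain_map f t]. Since [t] avoids [v], this is
    [chain_map g s]. *)
Lemma prism_aug_boundary c :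
  aug_boundary T (prism c) + prism (aug_boundary T c) = chain_map f c + chain_map g c.
Proof.
have tail (y t : chain T) : y = cone v t -> prism t = 0 -> chain_map f t = chain_map g t ->
    cone (g v) (chain_map f (aug_boundary T y)) + prism (aug_boundary T y)
    = chain_map g y.
  move=> -> t0 fgt.
  have := prism_cone (aug_boundary T t); have := aug_boundary_cone v t.
  generalize (cone v (aug_boundary T t)) => z.
  generalize (aug_boundary T (cone v t)) => y' -> pz.
  have E1 : cone (g v) (chain_map f (t + z))
          = cone (g v) (chain_map f t) + cone (g v) (chain_map f z).
    exact: etrans (congr1 (cone (g v)) (lfunD (chain_map f) t z)) (lfunD _ _ _).
  have E2 : prism (t + z) = 0 + cone (g v) (chain_map f z).
    exact: etrans (lfunD prism t z) (congr2 +%R t0 pz).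
  apply: (etrans (congr2 +%R E1 E2)); rewrite add0r -addrA addcc addr0.
  exact: etrans (congr1 (cone (g v)) fgt) (esym (chain_map_cone g v t)).
suff : ((aug_boundary T \o prism) + (prism \o aug_boundary T))%VF c
       = (chain_map f + chain_map g)%VF c.
  by rewrite !add_lfunE !comp_lfunE.
apply: eq_lin => s {c}; rewrite !add_lfunE !comp_lfunE.
have [vs|vs] := boolP (v \in s); last first.
  rewrite [X in aug_boundary T X]prismE (negPf vs) lfun0 add0r.
  rewrite [X in X + _](chain_map_agree vs) addcc.
  rewrite aug_boundaryE lfun_sum big1 // => w _.
  by rewrite prismE finset.in_setD1 (negPf vs) andbF.
rewrite prismE vs aug_boundary_cone chain_map_aug_boundary -addrA; congr (_ + _).
apply: tail (coneE vs) _ _.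
  by rewrite prismE setD11.
by apply: chain_map_agree; rewrite setD11.
Qed.

Lemma chain_map_step K K' q c : face_closed K' ->
  (forall s, s \in K -> f @: s :|: g @: s \in K') ->
  c \in cycles K q -> chain_map f c + chain_map g c \in boundaries K' q.
Proof.
move=> cK' fgK cc.
have -> : chain_map f c + chain_map g c = boundary T (prism c).
  have dc := drop_empty_chains (cycles_chains cc).
  (* The augmented boundary of a cycle is at most the empty face, which [prism] kills. *)
  have pa0 : prism (aug_boundary T c) = 0.
    have bc := etrans (esym (boundaryE c)) (cycles_boundary cc).
    exact: etrans (esym (prism_drop _)) (etrans (congr1 prism bc) (lfun0 prism)).
  have dE h : chain_map h c = drop_empty T (chain_map h c).
    exact: etrans (esym (congr1 (chain_map h) dc)) (chain_map_drop h c).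
  apply: etrans (congr2 +%R (dE f) (dE g)) _.
  apply: etrans (esym (lfunD (drop_empty T) _ _)) _.
  apply: etrans (congr1 (drop_empty T) (esym (prism_aug_boundary c))) _.
  apply: etrans (congr1 (fun x => drop_empty T (_ + x)) pa0) _.
  by rewrite addr0; apply: esym (boundaryE _).
apply: memv_img; apply: chains_image (cycles_chains cc) => s sK sq.
rewrite prismE; case: ifP => vs; rewrite ?mem0v // chain_mapE.
case: eqP => [e|_]; rewrite ?lfun0 ?mem0v // cone_chainE.
case: ifPn => gv; rewrite ?mem0v // mem_chains ?cardsU1 ?gv ?e ?sq //.
apply: (cK' _ _ (fgK s sK)); last by apply/set0Pn; exists (g v); rewrite setU11.
by rewrite finset.subUset finset.sub1set finset.in_setU imset_f ?orbT //= finset.subsetUl.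
Qed.

End Prism.

(* Contiguous maps are connected by maps that change one vertex at a time. *)
Lemma chain_map_id_homotopic f K K' q c : face_closed K' ->
  (forall s, s \in K -> s :|: f @: s \in K') ->
  c \in cycles K q -> chain_map id c + chain_map f c \in boundaries K' q.
Proof.
move=> cK' fK cc; pose F (l : seq T) v := if v \in l then f v else v.
have sK s l : s \in K -> F l @: s \subset s :|: f @: s.
  move=> sK; apply/fintype.subsetP => _ /imsetP[v vs ->]; rewrite /F finset.in_setU.
  by case: ifP => _; rewrite ?imset_f ?orbT ?vs.
have step l : chain_map id c + chain_map (F l) c \in boundaries K' q.
  elim: l => [|a l IH].
    by rewrite (_ : F [::] = id) ?addcc ?mem0v //; apply/funext.
  rewrite (addcK (chain_map id c) (chain_map (F l) c)).
  apply: (memvD IH); apply: (@chain_map_step _ _ a _ K _ _ _ cK' _ cc).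
    by move=> w wa; rewrite /F in_cons (negPf wa).
  move=> s sK1; have [s0|[u us]] := finset.set_0Vmem s.
    by move: (fK s sK1); rewrite s0 !imset0.
  apply: (cK' _ _ (fK s sK1)); first by rewrite finset.subUset !sK.
  by apply/set0Pn; exists (F l u); rewrite finset.in_setU imset_f.
rewrite (_ : f = F (enum T)) //; apply/funext => v.
by rewrite /F mem_enum.
Qed.

End Homotopy.

(** * Rips complexes of nets *)

Section Rips.
Variables (R : realType) (M : metricType R) (V : {fset M}).
Implicit Types (W : {set V}) (u v : V) (r : R).

Lemma pdist_sym u v : pdist u v = pdist v u.
Proof. exact: metric_sym. Qed.

Lemma pdist_triangle u v w : pdist u w <= pdist u v + pdist v w.
Proof. exact: metric_triangle. Qed.

Lemma pdistxx v : pdist v v = 0.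
Proof. exact: mdistxx. Qed.

Lemma ripsP r W (s : {set V}) :
  reflect [/\ s != finset.set0, s \subset W & {in s &, forall u v, pdist u v <= r}]
          (s \in rips r W).
Proof.
rewrite inE; apply: (iffP and3P) => -[s0 sW h]; split=> //.
  move=> u v us vs; move/'forall_implyP: h => /(_ u us)/'forall_implyP.
  exact.
by apply/'forall_implyP => u us; apply/'forall_implyP => v vs; apply: h.
Qed.

Lemma rips_face_closed r W : face_closed (rips r W).
Proof.
move=> s t /ripsP[_ sW h] ts t0; apply/ripsP; split=> //.
  exact: fintype.subset_trans sW.
by move=> u v /(fintype.subsetP ts) us /(fintype.subsetP ts); apply: h.
Qed.

Lemma rips_simplicial (f : V -> V) r r' W W' :
  {in W, forall v, f v \in W'} ->
  {in W &, forall u v, pdist u v <= r -> pdist (f u) (f v) <= r'} ->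
  simplicial f (rips r W) (rips r' W').
Proof.
move=> fW fr s /ripsP[s0 /fintype.subsetP sW h]; apply/ripsP; split.
- by rewrite imset_eq0.
- by apply/fintype.subsetP => _ /imsetP[v /sW vW ->]; apply: fW.
by move=> _ _ /imsetP[u us ->] /imsetP[v vs ->]; apply: fr; rewrite ?sW ?h.
Qed.

Lemma chain_map_eq (f g : V -> V) r W q c : {in W, f =1 g} ->
  c \in cycles (rips r W) q -> chain_map f c = chain_map g c.
Proof.
move=> fg /cycles_chains; apply: eq_lin_chains => s /ripsP[_ /fintype.subsetP sW _] _.
rewrite [LHS]chain_mapE [RHS]chain_mapE (_ : f @: s = g @: s) //.
by apply: eq_in_imset => v /sW /fg.
Qed.

End Rips.

Lemma chain_map_id (T : finType) (c : chain T) : chain_map id c = c.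
Proof.
rewrite -[RHS]id_lfunE; apply: eq_lin => s.
by rewrite id_lfunE chain_mapE imset_id eqxx.
Qed.

(** * Projections onto the nets and the interleaving *)

Section Nets.
Variables (R : realType) (M : metricType R) (V : {fset M}).
Variables (alpha eps : R) (m : nat) (W : nat -> {set V}) (prj : nat -> V -> V).
Hypotheses (alpha_gt0 : 0 < alpha) (eps_ge0 : 0 <= eps).
Hypotheses (netW : net_sequence alpha eps m W) (prjW : nearest_point_maps m W prj).

Local Notation rs := (rips_scale alpha eps).

Fixpoint comp_prj (k : nat) (v : V) : V :=
  if k is k'.+1 then prj k' (comp_prj k' v) else v.

Lemma comp_prj_mem k v : (k <= m)%N -> comp_prj k v \in W k.
Proof.
elim: k => [|k IH] km; first by rewrite netW.1 finset.in_setT.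
by have [] := prjW km (IH (ltnW km)).
Qed.

(** The nets are nested, so [v] lies in every earlier one and is its own nearest point, at distance
    zero. *)
Lemma comp_prj_fix k v : (k <= m)%N -> v \in W k -> comp_prj k v = v.
Proof.
elim: k => //= k IH km vW; have [/fintype.subsetP sW _ _] := netW.2 _ km.
rewrite IH ?(ltnW km) ?sW //; have [_ /(_ v vW)] := prjW km (sW _ vW).
rewrite pdistxx => d0; apply/esym/val_inj/mdist_positivity/eqP.
by rewrite eq_le d0 mdist_ge0.
Qed.

(* The net radii form a geometric sequence of ratio 1 + eps, with sum of order
   1 / eps times the last one. *)
Lemma comp_prj_dist k v : (k <= m)%N ->
  pdist v (comp_prj k v) <= alpha * eps / 2 * (1 + eps) ^ (k%:Z - 1).
Proof.
have e1 : 0 < 1 + eps by apply: ltr_pwDl.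
elim: k => [_|k IH km] /=.
  rewrite pdistxx; apply: mulr_ge0; last by apply: exprz_ge0; apply: ltW.
  by apply: divr_ge0 => //; apply: mulr_ge0 => //; apply: ltW.
apply: le_trans (pdist_triangle _ (comp_prj k v) _) _.
have wW := comp_prj_mem v (ltnW km).
have [_ near] := prjW km wW.
have [_ /(_ _ wW)[w' w'W d] _] := netW.2 _ km.
have := IH (ltnW km); have := le_trans (near _ w'W) d; rewrite /net_radius.
have -> : (1 + eps) ^ (k.+1%:Z - 1) = (1 + eps) ^ (k%:Z - 1) * (1 + eps).
  rewrite (_ : k.+1%:Z - 1 = (k%:Z - 1) + 1); last by lia.
  by rewrite expfzDr ?expr1z ?gt_eqF.
(* The new radius is [eps] times the bound for [k], so the sum is that bound times [1 + eps]. *)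
by set x := (1 + eps) ^ _; nra.
Qed.

(** The bound is half of the increase from [rs k] to [rs k.+1], so that both ends of an edge may
    move within one step of scale. *)
Lemma comp_prj_scale k v : (k < m)%N -> pdist v (comp_prj k.+1 v) <= rs k * eps / 2.
Proof.
move=> km; apply: le_trans (comp_prj_dist v km) _.
rewrite (_ : k.+1%:Z - 1 = k%:Z); last by lia.
by rewrite /rips_scale -exprnP; nra.
Qed.

Lemma rips_scaleS k : rs k.+1 = rs k + rs k * eps.
Proof. by rewrite /rips_scale exprSr; ring. Qed.

Lemma rips_scale_ge0 k : 0 <= rs k.
Proof. by rewrite mulr_ge0 ?exprn_ge0 ?addr_ge0 // ltW. Qed.

Lemma comp_prj_simplicial k : (k < m)%N ->
  simplicial (comp_prj k.+1) (rips (rs k) [set: V]) (rips (rs k.+1) (W k.+1)).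
Proof.
move=> km; apply: rips_simplicial => [v _|u v _ _ uv]; first exact: comp_prj_mem.
have := pdist_triangle (comp_prj k.+1 u) u (comp_prj k.+1 v).
have := pdist_triangle u v (comp_prj k.+1 v).
have := comp_prj_scale u km; have := comp_prj_scale v km.
rewrite [pdist (comp_prj k.+1 u) u]pdist_sym rips_scaleS.
by move: (comp_prj k.+1) => f; lra.
Qed.

Lemma comp_prj_contiguous k s : (k < m)%N -> s \in rips (rs k) [set: V] ->
  s :|: comp_prj k.+1 @: s \in rips (rs k.+1) [set: V].
Proof.
move=> km sK; have /ripsP[_ _ h'] := comp_prj_simplicial km sK.
have /ripsP[s0 _ h] := sK.
have e0 : 0 <= rs k * eps by rewrite mulr_ge0 ?rips_scale_ge0.
have mixed u v : u \in s -> v \in s -> pdist u (comp_prj k.+1 v) <= rs k.+1.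
  move=> us vs; apply: le_trans (pdist_triangle u v _) _.
  have := h u v us vs; have := comp_prj_scale v km; rewrite rips_scaleS.
  by move: (comp_prj k.+1) => f; lra.
apply/ripsP; split; last 1 first.
- move=> x y; rewrite !finset.in_setU.
  move=> /orP[xs|/imsetP[u us xu]] /orP[ys|/imsetP[v vs yv]].
  + by rewrite rips_scaleS; have := h x y xs ys; lra.
  + by rewrite yv mixed.
  + by rewrite xu pdist_sym mixed.
  + by rewrite xu yv h' ?imset_f.
- by apply: contraNneq s0 => e; rewrite -finset.subset0 -e finset.subsetUl.
- exact: finset.subsetT.
Qed.

Lemma rips_incl_simplicial k : simplicial id (rips (rs k) (W k)) (rips (rs k) [set: V]).
Proof. by apply: rips_simplicial => // v _; rewrite finset.in_setT. Qed.

Lemma rips_filtration_simplicial k :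
  simplicial id (rips (rs k) [set: V]) (rips (rs k.+1) [set: V]).
Proof.
apply: rips_simplicial => // u v _ _ uv; apply: le_trans uv _.
by rewrite rips_scaleS lerDl mulr_ge0 ?rips_scale_ge0.
Qed.

Lemma prj_comp_prj k : (k < m)%N -> {in W k, prj k =1 comp_prj k.+1}.
Proof. by move=> km v vW /=; rewrite comp_prj_fix // ltnW. Qed.

Lemma prj_simplicial k : (k < m)%N ->
  simplicial (prj k) (rips (rs k) (W k)) (rips (rs k.+1) (W k.+1)).
Proof.
move=> km s sK; have /ripsP[_ /fintype.subsetP sW _] := sK.
rewrite (_ : prj k @: s = comp_prj k.+1 @: s); last first.
  by apply: eq_in_imset => v /sW /(prj_comp_prj km).
apply: comp_prj_simplicial => //.
by have := rips_incl_simplicial sK; rewrite imset_id.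
Qed.

Definition net_incl q k := homology_map id (rips (rs k) (W k)) (rips (rs k) [set: V]) q.

Definition net_retract q k := homology_map (comp_prj k.+1)
  (rips (rs k) [set: V]) (rips (rs k.+1) (W k.+1)) q.

Lemma net_retract_incl q k (x : homology (rips (rs k) (W k)) q) : (k < m)%N ->
  homology_map (prj k) (rips (rs k) (W k)) (rips (rs k.+1) (W k.+1)) q x
    = net_retract q k (net_incl q k x).
Proof.
move=> km; have [c cK <-] := hclass_surj x.
have ci := chain_map_cycles (rips_incl_simplicial (k := k)) cK.
have fc k' (U : {set V}) : face_closed (rips (rs k') U) by exact: rips_face_closed.
have e1 := homology_mapE (fc _ _) (rips_incl_simplicial (k := k)) cK.
have e2 := homology_mapE (fc _ _) (comp_prj_simplicial km) ci.
have e3 := homology_mapE (fc _ _) (prj_simplicial km) cK.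
apply: etrans e3 (esym (etrans (congr1 (net_retract q k) e1) (etrans e2 _))).
have e := etrans (congr1 (chain_map (comp_prj k.+1)) (chain_map_id c))
                 (esym (chain_map_eq (prj_comp_prj km) cK)).
have e' := congr1 (hclass (rips (rs k.+1) (W k.+1)) q) e.
exact: e'.
Qed.

Lemma net_incl_retract q k (x : homology (rips (rs k) [set: V]) q) : (k < m)%N ->
  homology_map id (rips (rs k) [set: V]) (rips (rs k.+1) [set: V]) q x
    = net_incl q k.+1 (net_retract q k x).
Proof.
move=> km; have [c cK <-] := hclass_surj x.
have cp := chain_map_cycles (comp_prj_simplicial km) cK.
have cp' := chain_map_cycles (rips_incl_simplicial (k := k.+1)) cp.
have ci := chain_map_cycles (rips_filtration_simplicial (k := k)) cK.
have fc k' (U : {set V}) : face_closed (rips (rs k') U) by exact: rips_face_closed.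
have e1 := homology_mapE (fc _ _) (comp_prj_simplicial km) cK.
have e2 := homology_mapE (fc _ _) (rips_incl_simplicial (k := k.+1)) cp.
have e3 := homology_mapE (fc _ _) (rips_filtration_simplicial (k := k)) cK.
apply: etrans e3 (esym (etrans (congr1 (net_incl q k.+1) e1) (etrans e2 (esym _)))).
apply: hclass_eq => //.
rewrite [X in _ + X]chain_map_id.
apply: (chain_map_id_homotopic (rips_face_closed (W := _)) _ cK) => s.
exact: comp_prj_contiguous.
Qed.

Lemma net_rips_approximates : log_scale_approximates alpha eps m (3 * ln (1 + eps) / 2)
  (net_rips_homology alpha eps W prj) (rips_filtration_homology V alpha eps).
Proof.
move=> q X Y XA YB.
apply: (@zigzag_bottleneck _ (net_rips_homology alpha eps W prj q)
  (rips_filtration_homology V alpha eps q) m (net_incl q) (net_retract q)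
  _ _ _ _ _ _ _ _ XA YB).
- by move=> k km x; apply: net_retract_incl.
- by move=> k km x; apply: net_incl_retract.
(* Consecutive log-scales differ by [ln (1 + eps)], which is within the required bound. *)
move=> k; have e1 : 0 < 1 + eps by apply: ltr_pwDl.
have ln0 : 0 <= ln (1 + eps) by apply: ln_ge0; rewrite lerDl.
rewrite /rips_scale exprSr mulrA lnM ?posrE ?mulr_gt0 ?exprn_gt0 //.
by rewrite addrAC subrr add0r ger0_norm //; lra.
Qed.

End Nets.

(** * Sizes of skeleta in doubling spaces *)

Section Counting.
Variables (R : realType) (M : metricType R) (d : R).
Hypothesis doubling : is_doubling M d.

Lemma doubling_ge0 (x : M) : 0 <= d.
Proof.
have [s sd sc] := doubling x ltr01.
have [c cs _] : exists2 c, c \in s & mdist c x <= 1 / 2 by apply: sc; rewrite mdistxx.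
have : 1 <= 2 `^ d.
  by apply: le_trans sd; rewrite ler1n; case: s {sc} cs.
move=> /ln_ge0; rewrite ln_powR pmulr_lge0 // ln_gt0 //.
by rewrite ltr1n.
Qed.

Lemma doubling_cover t (x : M) r : 0 < r ->
  exists2 s : seq M, (size s)%:R <= (2 `^ d) ^+ t
    & forall y, mdist x y <= r -> exists2 c, c \in s & mdist c y <= r / 2 ^+ t.
Proof.
move=> r0; elim: t => [|t [s sd sc]].
  exists [:: x] => // y xy; exists x; first by rewrite mem_head.
  by rewrite expr0 divr1.
have rt0 : 0 < r / 2 ^+ t by rewrite divr_gt0 ?exprn_gt0.
have /choice[f fP] : forall c : M, exists s : seq M, (size s)%:R <= 2 `^ d /\
    forall y, mdist c y <= r / 2 ^+ t ->
      exists2 c', c' \in s & mdist c' y <= r / 2 ^+ t / 2.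
  by move=> c; have [s' ? ?] := doubling c rt0; exists s'.
exists (flatten (map f s)) => [|y xy].
  apply: (@le_trans _ _ ((size s)%:R * 2 `^ d)).
    elim: {sd sc} s => [|c s IH]; first by rewrite mul0r.
    by rewrite /= size_cat natrD mulrSr mulrDl mul1r addrC lerD // (fP c).1.
  by rewrite exprSr ler_wpM2r ?powR_ge0.
have [c cs cy] := sc y xy; have [c' c'f c'y] := (fP c).2 y cy.
exists c'; first by apply/flatten_mapP; exists c.
by rewrite exprSr invfM mulrA.
Qed.

Variable V : {fset M}.
Implicit Types (W : {set V}) (u v : V) (r : R).

Definition rips_nbhd r W u := [set v in W | pdist u v <= r].

(** Two points in a common ball of radius [r / 2 ^+ t] are within [delta], hence equal; so
    neighbours inject into the centers of a cover. *)
Lemma card_rips_nbhd t delta r W u : 0 < r -> 2 * r <= 2 ^+ t * delta ->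
  net_separated delta W -> #|rips_nbhd r W u|%:R <= (2 `^ d) ^+ t.
Proof.
move=> r0 rdelta sep; have [s sd sc] := doubling_cover t (val u) r0.
apply: le_trans sd; rewrite ler_nat.
have /choice[f fP] : forall v, exists c, pdist u v <= r ->
    c \in s /\ mdist c (val v) <= r / 2 ^+ t.
  move=> v; have [uv|_] := boolP (pdist u v <= r); last by exists (val u).
  by have [c] := sc _ uv; exists c.
rewrite cardE -(size_map f); apply: uniq_leq_size; last first.
  move=> _ /mapP[v + ->]; rewrite mem_enum inE => /andP[_ uv].
  by have [] := fP v uv.
rewrite map_inj_in_uniq ?enum_uniq // => v w.
rewrite !mem_enum !inE => /andP[vW uv] /andP[wW uw] e.
apply/eqP; apply: contraT => vw; have := sep v w vW wW vw.
have [_ fv] := fP v uv; have [_ fw] := fP w uw; move: fw; rewrite -e => fw.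
have := metric_triangle (val v) (f v) (val w).
rewrite [mdist (val v) (f v)]metric_sym -[mdist (val v) (val w)]/(pdist v w).
have : 2 * (r / 2 ^+ t) <= delta.
  by rewrite mulrA ler_pdivrMr ?exprn_gt0 // [delta * _]mulrC.
by lra.
Qed.

(* A simplex is determined by one of its vertices v and p neighbours of v, with
   repetitions, and v itself for padding. *)
Lemma card_skeleton_rips p r W (B : R) :
  (forall v, v \in W -> #|rips_nbhd r W v|%:R <= B) ->
  #|skeleton (rips r W) p|%:R <= #|W|%:R * B ^+ p.
Proof.
move=> nB.
pose S v := [set v |: [set f i | i in 'I_p]
  | f : {ffun 'I_p -> V} in ffun_on (rips_nbhd r W v)].
have sub : skeleton (rips r W) p \subset \bigcup_(v in W) S v.
  apply/fintype.subsetP => s; rewrite inE => /andP[/ripsP[/set0Pn[v vs] + h] sp].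
  move=> /fintype.subsetP sW.
  apply/finset.bigcupP; exists v; first exact: sW.
  have ns i : nth v (enum (s :\ v)) i \in s.
    have [ilt|ige] := ltnP i (size (enum (s :\ v))); last by rewrite nth_default.
    by have := mem_nth v ilt; rewrite mem_enum finset.in_setD1 => /andP[].
  apply/imsetP; exists [ffun i : 'I_p => nth v (enum (s :\ v)) i].
    by apply/ffun_onP => i; rewrite ffunE inE sW ?h.
  apply/finset.setP => x; rewrite finset.in_setU1; apply/idP/orP => [xs|].
    have [->|xv] := eqVneq x v; [by left|right].
    have xe : x \in enum (s :\ v) by rewrite mem_enum finset.in_setD1 xv.
    have ip : (index x (enum (s :\ v)) < p)%N.
      rewrite (leq_trans (n := #|s :\ v|)) //; first by rewrite cardE index_mem.
      by move: sp; rewrite (cardsD1 v) vs.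
    by apply/imsetP; exists (Ordinal ip); rewrite // ffunE nth_index.
  by case=> [/eqP ->//|/imsetP[i _ ->]]; rewrite ffunE.
apply: (@le_trans _ _ (\sum_(v in W) #|S v|%:R)).
  rewrite -natr_sum ler_nat; apply: leq_trans (subset_leq_card sub) _.
  elim/big_rec2: _ => [|v x A _ IH]; first by rewrite cards0.
  by rewrite (leq_trans (leq_card_setU _ _)) ?leq_add2l.
rewrite -sum1_card natr_sum mulr_suml; apply: ler_sum => v vW; rewrite mul1r.
apply: (@le_trans _ _ (#|rips_nbhd r W v| ^ p)%:R).
  rewrite ler_nat; apply: leq_trans (leq_imset_card _ _) _.
  by rewrite card_ffun_on card_ord.
by rewrite natrX lerXn2r ?nnegrE ?ler0n // ?nB // (le_trans _ (nB v vW)).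
Qed.

End Counting.

(** The least power of two above [y] works, as the previous one is below [y]. This fixes the number
    of halvings. *)
Lemma pow2_near (R : realType) (y : R) : 1 <= y ->
  exists t, y <= 2 ^+ t <= 2 * y.
Proof.
move=> y1; have ex : exists n, y <= 2 ^+ n.
  by exists (Num.bound y); apply/ltW/upper_nthrootP.
case: (ex_minnP ex) => t yt tmin; exists t; rewrite yt /=.
case: t yt tmin => [|t] yt tmin; first by rewrite expr0; lra.
have : 2 ^+ t < y by rewrite ltNge; apply/negP => /tmin; rewrite ltnn.
by rewrite exprS; lra.
Qed.

Lemma net_sequence_separated (R : realType) (M : metricType R) (V : {fset M})
    (alpha eps : R) (m k : nat) (W : nat -> {set V}) :
  net_sequence alpha eps m W -> (k <= m)%N ->
  (k = 0%N -> net_separated (net_radius alpha eps (-1)) (W 0%N)) ->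
  net_separated (net_radius alpha eps (k%:Z - 1)) (W k).
Proof.
move=> [_ netW]; case: k => [_ /(_ erefl)//|k km _].
rewrite (_ : k.+1%:Z - 1 = k%:Z); last by lia.
by have [] := netW k km.
Qed.

Lemma card_skeleton_net_rips (R : realType) (M : metricType R) (V : {fset M})
    (d alpha eps : R) (p m k : nat) (W : nat -> {set V}) :
  is_doubling M d -> 0 < alpha -> 0 < eps <= 1 ->
  net_sequence alpha eps m W -> (k <= m)%N ->
  (k = 0%N -> net_separated (net_radius alpha eps (-1)) (W 0%N)) ->
  #|skeleton (rips (rips_scale alpha eps k) (W k)) p|%:R
    <= (32 `^ d) ^+ p * eps^-1 `^ (2 * d * p%:R) * #|` V|%:R.
Proof.
move=> dM a0 /andP[e0 e1] netW km sep0.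
have sep := net_sequence_separated netW km sep0.
have WV : #|W k|%:R <= #|` V|%:R :> R by rewrite ler_nat cardfE max_card.
have C0 : 0 <= (32 `^ d) ^+ p * eps^-1 `^ (2 * d * p%:R).
  by rewrite mulr_ge0 ?exprn_ge0 ?powR_ge0.
rewrite mulrC; apply: le_trans (ler_wpM2r C0 WV).
(* The case of an empty [V] is separate: a point is needed to know that [d] is nonnegative. *)
have [v0 _|V0] := pickP {: V}; last first.
  apply: le_trans (@card_skeleton_rips _ _ _ p _ _ 0 _) _.
    by move=> v; have := V0 v.
  rewrite (_ : #|W k| = 0)%N ?mul0r //; apply: eq_card0 => v; by have := V0 v.
have d0 := doubling_ge0 dM (val v0).
have ie0 : 0 < eps^-1 by rewrite invr_gt0.
have ie1 : 1 <= eps^-1 by rewrite invf_ge1.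
(* Twice the scale over the separation is [4 (1 + eps)^2 / eps^2], at most [16 / eps^2] since
   [eps <= 1]. *)
have [|t /andP[yt ty]] := @pow2_near R (16 * eps^-1 ^+ 2); first by nra.
have -> : (32 `^ d) ^+ p * eps^-1 `^ (2 * d * p%:R) = ((32 * eps^-1 ^+ 2) `^ d) ^+ p.
  rewrite powRrM powR_mulrn ?powR_ge0 // powRrM powR_mulrn ?(ltW ie0) //.
  by rewrite [(32 * _) `^ d]powRM ?exprn_ge0 ?(ltW ie0) // exprMn.
apply: card_skeleton_rips => v _.
apply: (@le_trans _ _ ((2 `^ d) ^+ t)); last first.
  rewrite -powR_mulrn ?powR_ge0 // powRAC powR_mulrn //.
  apply: ge0_ler_powR; rewrite ?nnegrE ?exprn_ge0 ?mulr_ge0 ?exprn_ge0 ?(ltW ie0) //.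
  by apply: le_trans ty _; lra.
have s0 : 0 < 1 + eps by rewrite addr_gt0.
apply: (card_rips_nbhd dM) sep; first by rewrite /rips_scale mulr_gt0 ?exprn_gt0.
have -> : rips_scale alpha eps k = alpha * ((1 + eps) ^ (k%:Z - 1 - 1) * (1 + eps) ^+ 2).
  rewrite /rips_scale exprnP (exprnP _ 2) -expfzDr ?gt_eqF //.
  by congr (_ * _ ^ _); ring.
rewrite /net_radius; set x := (1 + eps) ^ _; have x0 : 0 < x by rewrite exprz_gt0.
apply: (@le_trans _ _ ((16 * eps^-1 ^+ 2) * (alpha * eps ^+ 2 / 2 * x))); last first.
  by rewrite ler_wpM2r // !mulr_ge0 ?exprn_ge0 // ltW.
have -> : 16 * eps^-1 ^+ 2 * (alpha * eps ^+ 2 / 2 * x) = 8 * (alpha * x).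
  by field; rewrite gt_eqF.
have : (1 + eps) ^+ 2 <= 4 by nra.
have ax : 0 < alpha * x by rewrite mulr_gt0.
by nra.
Qed.

Theorem theorem6p3 (R : realType) :
  exists c : R, forall (d : R) (p : nat), exists C : R,
  forall (M : metricType R) (V : {fset M}) (alpha eps : R) (m : nat)
    (W : nat -> {set V}) (prj : nat -> V -> V),
  doubling_dimension M d ->
  0 < alpha -> 0 <= eps <= 1 ->
  net_sequence alpha eps m W ->
  nearest_point_maps m W prj ->
  log_scale_approximates alpha eps m (3 * ln (1 + eps) / 2)
    (net_rips_homology alpha eps W prj)
    (rips_filtration_homology V alpha eps) /\
  (0 < eps -> forall k : nat, (k <= m)%N ->
     (k = 0%N -> net_separated (net_radius alpha eps (-1)) (W 0%N)) ->
     #|skeleton (rips (rips_scale alpha eps k) (W k)) p|%:R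
       <= C * (eps^-1) `^ (c * d * p%:R) * #|` V|%:R).
Proof.
(* Each of the [p] further vertices contributes a factor [(32 / eps^2)^d]: 32 goes into the
   constant, the square into the exponent. *)
exists 2 => d p; exists ((32 `^ d) ^+ p).
move=> M V alpha eps m W prj [dM _] a0 /andP[e0 e1] netW prjW; split.
  exact: net_rips_approximates prjW.
move=> e0' k km sep0.
by apply: (card_skeleton_net_rips p dM a0 _ netW km sep0); rewrite e0'.
Qed.
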